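(* Let $X(\cdot)$ be a process with state space $S$, let $N_j$, $j\in K=\{1,\dots,k\}$, be point processes, and suppose the assumptions (M1), (M2), (M3), (M4), (D1) and (D2) described in the context hold. Then for every $f\in C_b(S)$, $$\mathbb{E}_0\left[\Delta_jf(X)(0)\mid\Delta N_j(0)=1\right]=\mathbb{E}_j\left[\Delta_jf(X)(0)\right],\qquad j\in K_+,$$ and $$\alpha_0\,\mathbb{E}_0\left[\Delta f(X)(0)\right]=\sum_{j\in K_+}\alpha_j\,\mathbb{E}_j\left[\Delta_jf(X)(0)\right],$$ where $\mathbb{E}_j$ denotes expectation under the Palm distribution $\mathbb{P}_j$ for $j\in\{0\}\cup K_+$.
   Context: $(\Omega,\mathcal{F},\mathbb{F},\mathbb{P})$ is a stochastic basis with filtration $\mathbb{F}=\{\mathcal{F}_t;t\ge0\}$, $\mathcal{F}_\infty=\sigma(\bigcup_t\mathcal{F}_t)$; $\Theta_\bullet=\{\Theta_t;t\ge0\}$ is a shift operator semi-group on $\Omega$ ($\Theta_0(\omega)=\omega$, $\Theta_{s+t}=\Theta_s\circ\Theta_t$); $W\circ\Theta_s(\omega)=W(\Theta_s(\omega))$, $\Theta_s^{-1}A=\{\omega:\Theta_s(\omega)\in A\}$, and $\Theta_\sigma(\omega)=\Theta_{\sigma(\omega)}(\omega)$ for a random time $\sigma$. $S$ is a $(d+k)$-dimensional real vector space with Euclidean norm ($d,k$ positive integers); $C_b(S)$ is the set of bounded continuous functions $S\to\mathbb{R}$. $X(\cdot)=\{X(t);t\ge0\}$ is a (not necessarily Markov)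 $S$-valued process. The counting process of $N_j$ is $N_j(t)=N_j((0,t])$. For right-continuous $h$ with left limits, $\Delta h(t)=h(t)-h(t-)$. Assumptions: (M1) $X(\cdot)$ and $N_j(\cdot)$, $j\in K$, are $\mathbb{F}$-adapted with right-continuous sample paths having left-hand limits; $(t,\omega)\mapsto\Theta_t(\omega)$ is $\mathcal{B}(\mathbb{R}_+)\otimes\mathcal{F}/\mathcal{F}$-measurable; and for all $s,t\ge0$: $A\in\mathcal{F}_t$ implies $\Theta_s^{-1}A\in\mathcal{F}_{s+t}$, $X(t)\circ\Theta_s=X(s+t)$, $N_j(t)\circ\Theta_s=N_j(s+t)-N_j(s)$. (M2) There is $K_+\subset K$ such that $N_j$ is a locally finite simple point process for $j\in K_+$ and $N_j$ is null (identically zero) for $j\in K\setminus K_+$. Let $N_{\rm all}(t)=\sum_{j\in K}N_j(t)$, $t_0=0$, $t_n$ the $n$-th jump instant of $N_{\rm all}(\cdot)$ for $n\ge1$, and $N_0$ the simple point process with $N_0(t)=\sum_{n\ge1}1(t_n\le t)$. Different $N_j$ may have common points. Let $t_{j,m}$ be the $m$-th counting instant of $N_j(\cdot)$, $j\in K_+$. All these instants are positive, finite and increase to infinity. (M3) All discontinuity instants of $X(\cdot)$ are counted by $N_0(\cdot)$. (M4) There are $S$-valued random variables $Y_{j,n}$, $j\in\{0\}\cup K$, $n\ge0$, such that for $n\ge0$: (a) $Y_{0,n}=X(t_n-)$, $Y_{k,n}=X(t_n)$, and for $j\in K$, $Y_{j,n}=Y_{j-1,n}$ if $\Delta N_j(t_n)=0$;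 (b) for $j\in K$, $Y_{j,n}$ is an $\mathcal{F}_{t_n}$-measurable function of $Y_{j-1,n}$, where for a stopping time $\tau$, $\mathcal{F}_\tau=\{A\in\mathcal{F}:A\cap\{\tau\le t\}\in\mathcal{F}_t\ \forall t\ge0\}$; (c) $Y_{j,n}\circ\Theta_{t_m}=Y_{j,m+n}$ for $m\ge0$. (D1) $\mathbb{P}(A)=\mathbb{P}(\Theta_t^{-1}A)$ for all $A\in\mathcal{F}_\infty$, $t\ge0$. (D2) $0<\alpha_j<\infty$ for $j\in K_+$, where $\alpha_j=\mathbb{E}[N_j(1)]$. By stationarity the processes can be started at any negative time, so $X(0-)$ and $\Delta N_j(0)$ are well defined, with $X(0-)\circ\Theta_{t_m}=X(t_m-)$ and $\Delta N_j(0)\circ\Theta_{t_m}=\Delta N_j(t_m)$ for $m\ge1$. Palm distributions: with $\alpha_0=\mathbb{E}[N_0(1)]$, $\mathbb{P}_0(A)=\alpha_0^{-1}\mathbb{E}[\sum_{n\ge1}(1_A\circ\Theta_{t_n})1(t_n\le1)]$, and for $j\in K_+$, $\mathbb{P}_j(A)=\alpha_j^{-1}\mathbb{E}[\sum_{m\ge1}(1_A\circ\Theta_{t_{j,m}})1(t_{j,m}\le1)]$. $\Delta f(X)(t)=f(X(t))-f(X(t-))$ and $\Delta_jf(X)(t_n)=f(Y_{j,n})-f(Y_{j-1,n})$ for $j\in K$, $n\ge0$; in particular $\Delta_jf(X)(0)=f(Y_{j,0})-f(Y_{j-1,0})$. *)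

(* Defs.v *)
From HB Require Import structures.
From mathcomp Require Import all_boot all_order all_algebra.
From mathcomp Require Import all_classical all_reals all_analysis.
From mathcomp Require Import measurable_realfun.

Set Implicit Arguments.
Unset Strict Implicit.
Unset Printing Implicit Defensive.
Import Order.TTheory GRing.Theory Num.Theory.
Import numFieldNormedType.Exports.
Local Open Scope classical_set_scope.
Local Open Scope ring_scope.

(* Time is R, but only nonnegative times are ever constrained: the value of a
   path or of the filtration at t < 0 is irrelevant. *)

Definition left_lim {R : realType} {T : ptopologicalType} (h : R -> T) (t : R) : T :=
  lim (h x @[x --> t^'-]).

Definition cadlag {R : realType} {T : ptopologicalType} (h : R -> T) : Prop :=
  (forall t : R, 0 <= t -> h x @[x --> t^'+] --> h t) /\
  (forall t : R, 0 < t -> cvg (h x @[x --> t^'-])).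

Definition jump {R : realType} (h : R -> R) (t : R) : R := h t - left_lim h t.

(* jump_time h n is the n-th jump instant of h on ]0, +oo[, with the convention
   jump_time h 0 = 0; it is meaningful under jump_times_ok. *)
Definition jump_time {R : realType} (h : R -> R) (n : nat) : R :=
  iter n (fun u => inf [set s | u < s /\ jump h s != 0]) 0.

(* The jump instants are finite (there always is a next one, so the infimum in
   jump_time is over a nonempty set), positive and increase to infinity. *)
Definition jump_times_ok {R : realType} (h : R -> R) : Prop :=
  [/\ forall n, [set s | jump_time h n < s /\ jump h s != 0] !=set0,
      forall n, jump_time h n < jump_time h n.+1
    & jump_time h n @[n --> \oo] --> +oo].

Definition borel (T : topologicalType) : set (set T) := <<s [set U : set T | open U] >>.

Definition measurable_wrt {Omega : Type} {T : topologicalType}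
    (G : set (set Omega)) (f : Omega -> T) : Prop :=
  forall B, borel B -> G (f @^-1` B).

Section model.
Context {R : realType} {disp : measure_display} {Omega : measurableType disp}.
Implicit Types (F : R -> set (set Omega)) (Theta : R -> Omega -> Omega).

Record is_filtration F : Prop := {
  filtration_sigma : forall t : R, 0 <= t -> sigma_algebra [set: Omega] (F t) ;
  filtration_sub : forall t : R, 0 <= t -> F t `<=` measurable ;
  filtration_mono : forall s t : R, 0 <= s -> s <= t -> F s `<=` F t }.

Definition F_infty F : set (set Omega) :=
  <<s \bigcup_(t in [set t : R | 0 <= t]) F t >>.

Definition F_stop F (tau : Omega -> R) : set (set Omega) :=
  [set A | measurable A /\
    forall t : R, 0 <= t -> F t (A `&` [set w | tau w <= t])].

Record is_shift Theta : Prop := {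
  shift0 : forall w, Theta 0 w = w ;
  shiftD : forall s t : R, 0 <= s -> 0 <= t ->
    forall w, Theta (s + t) w = Theta s (Theta t w) }.

Definition shift_at Theta (tau : Omega -> R) (w : Omega) : Omega :=
  Theta (tau w) w.

(* A point process on ]0, +oo[ is a random integer-valued (possibly infinite)
   measure; it is stored as a measure on R that does not charge ]-oo, 0]. *)
Definition random_measure := Omega -> {measure set (measurableTypeR R) -> \bar R}.
Implicit Types N : random_measure.

Record point_process N : Prop := {
  pp_measurable : forall B : set (measurableTypeR R), measurable B ->
    measurable_fun setT (fun w => N w B) ;
  pp_support : forall w, N w `]-oo, 0%R]%classic = 0%E ;
  pp_integer : forall w (B : set (measurableTypeR R)), measurable B ->
    N w B = +oo%E \/ exists n : nat, N w B = n%:R%:E }.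

Definition locally_finite N : Prop := forall w (t : R), (N w `]0%R, t]%classic < +oo)%E.

Definition simple_pp N : Prop := forall w (t : R), (N w [set t] <= 1)%E.

Definition null_pp N : Prop :=
  forall w (B : set (measurableTypeR R)), measurable B -> N w B = 0%E.

Definition counting N (t : R) (w : Omega) : R := fine (N w `]0%R, t]%classic).

Definition instant N (m : nat) (w : Omega) : R := jump_time (counting N ^~ w) m.

Section palm.
Local Open Scope ereal_scope.

(* The Palm distribution of the instants tau 1, tau 2, etc. with intensity
   alpha, written as a plain set function: the library integral is defined for
   an arbitrary set function, and only uses its values on measurable sets. *)
Definition palm (P : probability Omega R) Theta (alpha : \bar R)
    (tau : nat -> Omega -> R) (A : set Omega) : \bar R :=
  alpha^-1 * \int[P]_w \sum_(1 <= n <oo)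
    (\1_A (shift_at Theta (tau n) w) * \1_[set s : R | (s <= 1)%R] (tau n w))%:E.

Definition expect (Q : set Omega -> \bar R) (Z : Omega -> R) : \bar R :=
  \int[Q]_w (Z w)%:E.

(* Elementary conditional expectation given an event. *)
Definition cond_expect (Q : set Omega -> \bar R) (Z : Omega -> R)
    (A : set Omega) : \bar R :=
  (\int[Q]_(w in A) (Z w)%:E) / Q A.

End palm.

Section processes.
(* S = R^(d+k); only the topology of S is used, and the library topology of row
   vectors is the one of the Euclidean norm. The index set K = {1, ..., k} is
   represented by 'I_k. *)
Context {d k : nat}.
Local Notation S := 'rV[R]_(d + k).
Implicit Types (X : R -> Omega -> S) (NN : 'I_k -> random_measure)
  (Kp : {set 'I_k}) (Xzm : Omega -> S) (DNz : 'I_k -> Omega -> R)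
  (Y : 'I_k.+1 -> nat -> Omega -> S).

Definition Nall NN (t : R) (w : Omega) : R := \sum_(j < k) counting (NN j) t w.

Definition t_all NN (n : nat) (w : Omega) : R := jump_time (Nall NN ^~ w) n.

Definition Nzero NN (t : R) (w : Omega) : \bar R :=
  (\sum_(1 <= n <oo) (\1_[set s : R | (s <= t)%R] (t_all NN n w))%:E)%E.

Definition alpha (P : probability Omega R) NN (j : 'I_k) : \bar R :=
  ('E_P[counting (NN j) 1])%E.

Definition alpha0 (P : probability Omega R) NN : \bar R :=
  (\int[P]_w Nzero NN 1 w)%E.

Definition palm_at (P : probability Omega R) Theta NN (j : 'I_k) :=
  palm P Theta (alpha P NN j) (instant (NN j)).

Definition palm0 (P : probability Omega R) Theta NN :=
  palm P Theta (alpha0 P NN) (t_all NN).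

Record M1 F Theta X NN : Prop := {
  M1_adapted_X : forall t : R, 0 <= t -> measurable_wrt (F t) (X t) ;
  M1_adapted_N : forall j (t : R), 0 <= t -> measurable_wrt (F t) (counting (NN j) t) ;
  M1_cadlag_X : forall w, cadlag (X ^~ w) ;
  M1_cadlag_N : forall j w, cadlag (counting (NN j) ^~ w) ;
  M1_shift_measurable :
    measurable_fun ([set t : measurableTypeR R | 0 <= t] `*` [set: Omega])
      (fun p : measurableTypeR R * Omega => Theta p.1 p.2) ;
  M1_shift_F : forall s t : R, 0 <= s -> 0 <= t ->
    forall A, F t A -> F (s + t) (Theta s @^-1` A) ;
  M1_shift_X : forall s t : R, 0 <= s -> 0 <= t ->
    forall w, X t (Theta s w) = X (s + t) w ;
  M1_shift_N : forall j (s t : R), 0 <= s -> 0 <= t ->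
    forall w, counting (NN j) t (Theta s w) =
              counting (NN j) (s + t) w - counting (NN j) s w }.

Record M2 Kp NN : Prop := {
  M2_simple : forall j, j \in Kp -> locally_finite (NN j) /\ simple_pp (NN j) ;
  M2_null : forall j, j \notin Kp -> null_pp (NN j) ;
  M2_instants_all : forall w, jump_times_ok (Nall NN ^~ w) ;
  M2_instants : forall j, j \in Kp ->
    forall w, jump_times_ok (counting (NN j) ^~ w) }.

Definition M3 X NN : Prop := forall w (t : R), 0 < t ->
  ~ {for t, continuous (X ^~ w)} -> exists2 n, (0 < n)%N & t_all NN n w = t.

(* Xzm and DNz j are the random variables X(0-) and (Delta N_j)(0), provided by
   the stationary extension of the processes to negative times. *)
Record before_zero Theta X NN Xzm DNz : Prop := {
  bz_measurable_X : measurable_wrt (@measurable _ Omega) Xzm ;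
  bz_measurable_N : forall j, measurable_wrt (@measurable _ Omega) (DNz j) ;
  bz_shift_X : forall m, (0 < m)%N -> forall w,
    Xzm (shift_at Theta (t_all NN m) w) = left_lim (X ^~ w) (t_all NN m w) ;
  bz_shift_N : forall j m, (0 < m)%N -> forall w,
    DNz j (shift_at Theta (t_all NN m) w) =
      jump (counting (NN j) ^~ w) (t_all NN m w) }.

Definition Xleft X Xzm (t : R) (w : Omega) : S :=
  if t == 0 then Xzm w else left_lim (X ^~ w) t.

Definition DeltaN NN DNz (j : 'I_k) (t : R) (w : Omega) : R :=
  if t == 0 then DNz j w else jump (counting (NN j) ^~ w) t.

(* Y is indexed by {0} U K = {0, ..., k}. If i : 'I_k stands for j = i+1 in K,
   then cur i is the index j and prv i is the index j-1. *)
Definition cur (j : 'I_k) : 'I_k.+1 := lift ord0 j.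
Definition prv (j : 'I_k) : 'I_k.+1 := widen_ord (leqnSn k) j.

(* g : Omega -> S -> S is a G-measurable random function: jointly measurable
   for the product of G and the Borel sets of S. *)
Definition random_function (G : set (set Omega)) (g : Omega -> S -> S) : Prop :=
  forall B : set S, borel B ->
    <<s [set C | exists2 A : set Omega, G A &
                 exists2 D : set S, borel D & C = A `*` D] >>
      [set p : Omega * S | B (g p.1 p.2)].

Record M4 F Theta X NN Xzm DNz Y : Prop := {
  M4_rv : forall j n, measurable_wrt (@measurable _ Omega) (Y j n) ;
  M4a_first : forall n w, Y ord0 n w = Xleft X Xzm (t_all NN n w) w ;
  M4a_last : forall n w, Y ord_max n w = X (t_all NN n w) w ;
  M4a_const : forall (j : 'I_k) n w, DeltaN NN DNz j (t_all NN n w) w = 0 ->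
    Y (cur j) n w = Y (prv j) n w ;
  M4b : forall (j : 'I_k) n, exists2 g : Omega -> S -> S,
    random_function (F_stop F (t_all NN n)) g &
    forall w, Y (cur j) n w = g w (Y (prv j) n w) ;
  M4c : forall j m n w, Y j n (shift_at Theta (t_all NN m) w) = Y j (m + n)%N w }.

Definition D1 F Theta (P : probability Omega R) : Prop :=
  forall A (t : R), F_infty F A -> 0 <= t -> P A = P (Theta t @^-1` A).

Definition D2 Kp NN (P : probability Omega R) : Prop :=
  forall j, j \in Kp -> (0 < alpha P NN j < +oo)%E.

Definition Delta_f (f : S -> R) X Xzm (t : R) (w : Omega) : R :=
  f (X t w) - f (Xleft X Xzm t w).

Definition Delta_jf (f : S -> R) Y (j : 'I_k) (n : nat) (w : Omega) : R :=
  f (Y (cur j) n w) - f (Y (prv j) n w).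

End processes.
End model.

(* Main.v *)
(** For a sequence of random times tau, let M_tau(A) be the expected number of
    indices n >= 1 such that tau_n <= 1 and the shift by tau_n leads into A, so
    that the Palm distributions are the normalized measures M_tau. The instants
    of N_j are exactly the jump instants t_n of N_all at which N_j jumps, the
    jump is then 1, and Delta N_j(0) reads off this jump after the shift by t_n.
    Hence M_j is the restriction of M_0 to the event Delta N_j(0) = 1, which has
    M_0-mass alpha_j: this is the first identity. For the second one, Delta f is
    the telescoping sum of the Delta_j f, and Delta_j f vanishes M_0-almost
    everywhere outside of that event. *)

Require Import Defs.
From HB Require Import structures.
From mathcomp Require Import all_boot all_order all_algebra.
From mathcomp Require Import all_classical all_reals all_analysis.
From mathcomp Require Import measurable_realfun.

Set Implicit Arguments.
Unset Strict Implicit.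
Unset Printing Implicit Defensive.
Import Order.TTheory GRing.Theory Num.Theory.
Import numFieldNormedType.Exports.
Local Open Scope classical_set_scope.
Local Open Scope ring_scope.

(** * Integer-valued paths and their jumps *)

(** Common ground of the paths of each $N_j$ and of $N_{\rm all}$: these conditions pass to finite
    sums and already force left limits to exist. *)
Record step_path {R : realType} (h : R -> R) : Prop := {
  step_nat : forall t, exists n : nat, h t = n%:R ;
  step_homo : {homo h : s t / s <= t} ;
  step_right : forall t, 0 <= t -> h x @[x --> t^'+] --> h t }.

Section step_path_theory.
Context {R : realType}.
Implicit Types h : R -> R.

Lemma step_lt h s t : step_path h -> h s < h t -> h s + 1 <= h t.
Proof.
move=> hh; have [[m ->] [n ->]] := (step_nat hh s, step_nat hh t).
by rewrite ltr_nat natr1 ler_nat.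
Qed.

(** Right-continuity keeps the values just after [t] within distance less than 1 of [h t], while an
    increase of an integer-valued path is at least 1. *)
Lemma step_right_const h t : step_path h -> 0 <= t ->
  \forall x \near t^'+, h x = h t.
Proof.
move=> hh t0; have /cvgrPdist_lt/(_ 1 ltr01) := step_right hh t0.
apply: filterS2 (nbhs_right_gt t) => x tx htx.
apply/eqP; rewrite eq_le (step_homo hh (ltW tx)) andbT leNgt.
apply/negP => /(step_lt hh); rewrite leNgt => /negP; apply.
by rewrite addrC -ltrBlDr (le_lt_trans (ler_norm _))// distrC.
Qed.

(** The integers taken as values before [t] are bounded by [h t], so one of them is the largest;
    from a point where it is attained, monotonicity freezes the path until [t]. *)
Lemma step_left_const h t : step_path h ->
  exists2 s, s < t & forall x, s <= x < t -> h x = h s.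
Proof.
move=> hh; pose Q := [pred n : nat | `[< exists2 s, s < t & h s = n%:R >]].
have exQ : exists n, Q n.
  have [n hn] := step_nat hh (t - 1).
  by exists n; apply/asboolP; exists (t - 1) => //; rewrite ltrBlDr ltrDl.
have [N hN] := step_nat hh t.
have ubQ n : Q n -> (n <= N)%N.
  by move=> /asboolP[s st hs]; rewrite -(ler_nat R) -hs -hN (step_homo hh (ltW st)).
case: (ex_maxnP exQ ubQ) => n /asboolP[s st hs] nmax.
exists s => // x /andP[sx xt]; apply/eqP; rewrite eq_le (step_homo hh sx) andbT.
have [m hm] := step_nat hh x.
by rewrite hm hs ler_nat nmax//; apply/asboolP; exists x.
Qed.

Lemma step_left_lim h t : step_path h ->
  exists2 s, s < t & forall x, s <= x < t -> h x = left_lim h t.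
Proof.
move=> hh; have [s st sE] := step_left_const t hh; exists s => // x sxt.
rewrite sE//; apply/esym/cvg_lim; first exact: Rhausdorff.
apply: cvg_near_cst.
apply: filterS2 (nbhs_left_lt t) (nbhs_left_ge st) => y yt sy.
by rewrite sE// sy.
Qed.

Lemma step_cvg_left h t : step_path h -> h x @[x --> t^'-] --> left_lim h t.
Proof.
move=> hh; have [s st sE] := step_left_lim t hh.
apply: cvg_near_cst.
by apply: filterS2 (nbhs_left_lt t) (nbhs_left_ge st) => y yt sy; rewrite sE// sy.
Qed.

Lemma step_le_left_lim h s t : step_path h -> s < t -> h s <= left_lim h t.
Proof.
move=> hh st; have [u ut uE] := step_left_lim t hh.
by rewrite -(uE (Num.max s u)) ?(step_homo hh)// ?le_max ?lexx ?orbT// gt_max st ut.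
Qed.

Lemma step_left_lim_le h t : step_path h -> left_lim h t <= h t.
Proof.
move=> hh; have [u ut uE] := step_left_lim t hh.
by rewrite -(uE u) ?lexx//; apply: (step_homo hh); exact: ltW.
Qed.

Lemma step_jump_nat h t : step_path h -> exists n : nat, jump h t = n%:R.
Proof.
move=> hh; have [u ut uE] := step_left_lim t hh.
have := step_left_lim_le t hh; rewrite /jump -(uE u) ?lexx//.
have [[m ->] [n ->]] := (step_nat hh u, step_nat hh t).
by rewrite ler_nat => mn; exists (n - m)%N; rewrite natrB.
Qed.

Lemma step_jump_lt h s t : step_path h -> s < t -> jump h t != 0 -> h s < h t.
Proof.
move=> hh st; rewrite /jump subr_eq0 => j0.
by rewrite (le_lt_trans (step_le_left_lim hh st))// lt_neqAle eq_sym j0 step_left_lim_le.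
Qed.

(** The jump sits at the infimum [s] of the points after [u] where [h] exceeds [h u]: constancy
    right of [s] gives [h s > h u], and just before [s] the path has not yet exceeded [h u]. *)
Lemma step_exists_jump h u v : step_path h -> 0 <= u -> h u < h v ->
  exists2 s, u < s <= v & jump h s != 0.
Proof.
move=> hh u0 huv.
have uv : u < v by rewrite ltNge; apply: contraTN huv => /(step_homo hh); rewrite leNgt.
pose E := [set x | u < x /\ h u < h x]; pose s := inf E.
have Ev : E v by [].
have lbE : lbound E u by move=> x [/ltW].
have infE : has_inf E by split; [exists v|exists u].
have us : u <= s by apply: lb_le_inf => //; exists v.
have s0 : 0 <= s := le_trans u0 us.
have hus : h u < h s.
  have : \forall x \near s^'+, h x = h s := step_right_const hh s0.
  rewrite near_withinE => -[e /= e0 He].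
  have [x Ex xs] := inf_adherent e0 infE.
  have := inf_lbound (ex_intro _ u lbE) Ex; rewrite -/s le_eqVlt => /predU1P[->|sx].
    by case: Ex.
  rewrite -(He x) => //; first by case: Ex.
  by rewrite /ball/= ltr0_norm ?subr_lt0// opprB ltrBlDl.
have us' : u < s.
  by rewrite lt_neqAle us andbT; apply: contraTneq hus => <-; rewrite ltxx.
exists s; first by rewrite us'/= inf_lbound//; exists u.
have [r rs rE] := step_left_lim s hh.
pose x := Num.max r u.
have xs : x < s by rewrite gt_max rs us'.
rewrite /jump subr_eq0 -(rE x) ?le_max ?lexx// gt_eqF// (le_lt_trans _ hus)//.
rewrite leNgt; apply/negP => hux.
have Ex : E x.
  split=> //; rewrite ltNge; apply: contraTN hux => /(step_homo hh).
  by rewrite leNgt.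
by have := inf_lbound (ex_intro _ u lbE) Ex; rewrite leNgt xs.
Qed.

Lemma step_path_sum (I : Type) (r : seq I) (H : I -> R -> R) :
  (forall i, step_path (H i)) -> step_path (fun t => \sum_(i <- r) H i t).
Proof.
move=> hH; split.
- move=> t; elim: r => [|i r [n ih]]; first by exists 0%N; rewrite big_nil.
  have [m hm] := step_nat (hH i) t.
  by exists (m + n)%N; rewrite big_cons ih hm natrD.
- by move=> s t st; apply: ler_sum => i _; exact: (step_homo (hH i)).
- move=> t t0.
  elim: r => [|i r ih].
    under eq_fun do rewrite big_nil.
    by rewrite big_nil; exact: cvg_cst.
  under eq_fun do rewrite big_cons.
  by rewrite big_cons; apply: cvgD => //; exact: (step_right (hH i)).
Qed.

Lemma jump_sum (I : Type) (r : seq I) (H : I -> R -> R) t :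
  (forall i, step_path (H i)) ->
  jump (fun t => \sum_(i <- r) H i t) t = \sum_(i <- r) jump (H i) t.
Proof.
move=> hH; rewrite /jump sumrB; congr (_ - _).
apply: cvg_lim; first exact: Rhausdorff.
elim: r => [|i r ih].
  under eq_fun do rewrite big_nil.
  by rewrite big_nil; exact: cvg_cst.
under eq_fun do rewrite big_cons.
by rewrite big_cons; apply: cvgD => //; exact: step_cvg_left.
Qed.

End step_path_theory.

(** * Enumeration of the jump instants of a step path *)

Section jump_times.
Context {R : realType}.
Variable h : R -> R.
Hypotheses (hh : step_path h) (hT : jump_times_ok h).
Local Notation T := (jump_time h).

Lemma jump_time_lt m n : (m < n)%N -> T m < T n.
Proof.
case: hT => _ Tlt _; elim: n => // n ih; rewrite ltnS leq_eqVlt => /predU1P[->|].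
  exact: Tlt.
by move=> /ih /lt_trans; apply; exact: Tlt.
Qed.

Lemma jump_time_ltP m n : (T m < T n) = (m < n)%N.
Proof.
apply/idP/idP; last exact: jump_time_lt.
rewrite ltnNge; apply: contraTN; rewrite -leNgt leq_eqVlt => /predU1P[->//|].
by move=> /jump_time_lt /ltW.
Qed.

Lemma jump_time_inj : injective T.
Proof.
move=> m n mn; case: (ltngtP m n) => // /jump_time_lt; by rewrite mn ltxx.
Qed.

Lemma jump_time_ge0 n : 0 <= T n.
Proof. by rewrite -[0]/(T 0) leNgt jump_time_ltP. Qed.

Lemma jump_time_gt0 n : 0 < T n.+1.
Proof. by rewrite -[0]/(T 0) jump_time_ltP. Qed.

Lemma jump_time_min n s : T n < s -> jump h s != 0 -> T n.+1 <= s.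
Proof. by move=> Tns js; apply: inf_lbound => //; exists (T n) => x [/ltW]. Qed.

(* The infimum defining the next jump instant is attained: right of it the
   path is locally constant, so that jumps cannot accumulate there. *)
Lemma jump_timeS_jump n : jump h (T n.+1) != 0.
Proof.
have [ne Tlt _] := hT.
pose E := [set s | T n < s /\ jump h s != 0].
have lbE : lbound E (T n) by move=> x [/ltW].
have infE : has_inf E by split; [exact: ne|exists (T n)].
have := step_right_const hh (jump_time_ge0 n.+1).
rewrite near_withinE => -[e e0' He]; have e0 : 0 < e := e0'.
have [s Es se] := inf_adherent e0 infE.
have [Tns js] := Es.
have := jump_time_min Tns js; rewrite le_eqVlt => /predU1P[->//|Ts].
have [r rs rE] := step_left_lim s hh.
have [x /andP[Tx xs] rx] : exists2 x, T n.+1 < x < s & r <= x.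
  exists (Num.max r ((T n.+1 + s) / 2)); last by rewrite le_max lexx.
  by rewrite lt_max gt_max rs (midf_lt Ts).1 (midf_lt Ts).2 orbT.
have hc y : T n.+1 < y <= s -> h y = h (T n.+1).
  move=> /andP[Ty ys]; apply: He => //; rewrite /ball/= ltr0_norm ?subr_lt0//.
  by rewrite opprB ltrBlDl (le_lt_trans ys).
by move: js; rewrite /jump -(rE x) ?rx// !hc ?lexx ?Ts ?Tx ?(ltW xs)// subrr eqxx.
Qed.

(** Since the instants diverge, there is a first one at or after [s]; its predecessor lies before
    [s], so it cannot overshoot the jump at [s]. *)
Lemma jump_timeP s : 0 < s -> jump h s != 0 -> exists n, T n.+1 = s.
Proof.
move=> s0 js; have [_ _ /cvgryPge/(_ s) [N _ TN]] := hT.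
have exN : exists n, s <= T n by exists N; apply: TN => /=.
case: (ex_minnP exN) => -[|n] sTn nmin.
  by move: sTn; rewrite leNgt s0.
exists n; apply/eqP; rewrite eq_le sTn andbT jump_time_min// ltNge.
by apply/negP => /nmin; rewrite ltnn.
Qed.

(** Any increase after [T n] and before [T n.+1] would produce a jump strictly between two
    consecutive instants. *)
Lemma jump_timeS_left_lim n : left_lim h (T n.+1) = h (T n).
Proof.
have [_ Tlt _] := hT.
have [r rs rE] := step_left_lim (T n.+1) hh.
pose x := Num.max r (T n).
have xT : x < T n.+1 by rewrite gt_max rs Tlt.
rewrite -(rE x) ?le_max ?lexx//.
have Tx : T n <= x by rewrite le_max lexx orbT.
apply/eqP; rewrite eq_le (step_homo hh Tx) andbT leNgt; apply/negP.
move=> /(step_exists_jump hh (jump_time_ge0 n))[s /andP[Tns sx] js].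
by have := jump_time_min Tns js; rewrite leNgt (le_lt_trans sx).
Qed.

Local Open Scope ereal_scope.

(** The unordered sum forgets the numbering of the instants, so that series along the instants of
    different paths can be compared through their sets of times. *)
Lemma nneseries_jump_time (a : R -> \bar R) : (forall s, 0 <= a s) ->
  \sum_(1 <= n <oo) a (T n) = \esum_(s in [set s | (0 < s)%R /\ jump h s != 0%R]) a s.
Proof.
move=> a0; rewrite ereal_series nneseries_esum//.
apply/esym/reindex_esum; split.
- move=> [|n]//= _; split; [exact: jump_time_gt0|exact: jump_timeS_jump].
- by move=> m n _ _; exact: jump_time_inj.
- by move=> s /= [s0 js]; have [n <-] := jump_timeP s0 js; exists n.+1.
Qed.

(** Unit jumps starting from 0 give [h (T n) = n], so [h t] is the index of the last instant up to
    [t]. *)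
Lemma unit_jump_path t : (h 0 = 0)%R -> (forall s, 0 < s -> jump h s != 0 -> jump h s = 1)%R ->
  (0 <= t)%R -> (h t)%:E = \sum_(1 <= n <oo) (\1_[set s | (s <= t)%R] (T n))%:E.
Proof.
move=> h00 j1 t0.
have hTn n : (h (T n) = n%:R)%R.
  elim: n => [|n ih]; first exact: h00.
  have := j1 _ (jump_time_gt0 n) (jump_timeS_jump n); rewrite {1}/jump jump_timeS_left_lim ih.
  by move=> /eqP; rewrite subr_eq addrC natr1 => /eqP.
have [_ _ /cvgryPgt/(_ t) [N _ TN]] := hT.
have exN : exists n, (t < T n)%R by exists N; apply: TN => /=.
case: (ex_minnP exN) => -[|n] tTn nmin.
  by move: tTn; rewrite ltNge t0.
have Tnt : (T n <= t)%R.
  by rewrite leNgt; apply/negP => /nmin; rewrite ltnn.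
have -> : (h t = n%:R)%R.
  apply/eqP; rewrite -hTn eq_le (step_homo hh Tnt) andbT leNgt; apply/negP.
  move=> /(step_exists_jump hh (jump_time_ge0 n))[s /andP[Tns st] js].
  by have := jump_time_min Tns js; rewrite leNgt (le_lt_trans st).
(* Index 0 is time 0 and is not counted: exactly the indices 1 to [n] contribute, and later instants
   exceed [t]. *)
rewrite (@nneseries_split _ _ 1 n)//.
rewrite eseries0 ?adde0; last first.
  move=> i ni _; rewrite indicE memNset//= => Tit.
  have TT : (T n.+1 <= T i)%R by rewrite leNgt jump_time_ltP -leqNgt.
  by move: tTn; rewrite ltNge (le_trans TT Tit).
rewrite (eq_big_nat _ _ (F2 := fun=> 1)); last first.
  move=> i /andP[_ ni]; rewrite indicE mem_set//= (le_trans _ Tnt)//.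
  by rewrite leNgt jump_time_ltP -leqNgt.
by rewrite sumEFin sumr_const_nat addKn.
Qed.

End jump_times.

(** By induction on [n]: the next instant is before [a] iff there are rationals [q < r < a] with [q]
    after the [n]-th instant and [H q < H r]. This replaces the infimum by a countable union. *)
Lemma measurable_jump_time {R : realType} {d : measure_display} {Omega : measurableType d}
  (H : R -> Omega -> R) :
  (forall t, measurable_fun setT (H t)) -> (forall w, step_path (H ^~ w)) ->
  (forall w, jump_times_ok (H ^~ w)) ->
  forall n, measurable_fun setT (fun w => jump_time (H ^~ w) n).
Proof.
move=> mH hH hT; elim=> [|n ih]; first exact: measurable_cst.
apply: (measurability _ (RGenInftyO.measurableE R)) => //.
move=> /= _ [_ [a ->] <-]; rewrite setTI.
rewrite (_ : _ @^-1` _ = \bigcup_(q : rat) \bigcup_(r : rat)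
   (if (q < r) && (ratr r < a) then
   ((fun w => jump_time (H ^~ w) n) @^-1` `]-oo, (ratr q)[%classic `&`
    [set w | H (ratr q) w < H (ratr r) w]) else set0)).
  apply: bigcupT_measurable_rat => q; apply: bigcupT_measurable_rat => r.
  case: ifP => // _; apply: measurableI.
    by rewrite -[X in measurable X]setTI; apply: ih => //; exact: measurable_itv.
  rewrite -[X in measurable X]setTI.
  have mlt := @measurable_fun_ltr _ _ R _ _ _ (mH (ratr q)) (mH (ratr r)).
  exact: (mlt measurableT [set true]).
apply/seteqP; split => w /=; rewrite in_itv/=.
- move=> Ta; have [_ /(_ n) Tlt _] := hT w.
  have [q] := rat_in_itvoo Tlt; rewrite in_itv/= => /andP[Tq qT].
  have [r] := rat_in_itvoo Ta; rewrite in_itv/= => /andP[Tr ra].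
  exists q => //; exists r => //.
  rewrite -(ltr_rat R) (lt_trans qT Tr) ra; split; first by rewrite /= in_itv.
  rewrite /= (lt_le_trans (step_jump_lt (hH w) qT _))//.
    exact: (jump_timeS_jump (hH w) (hT w)).
  by rewrite (step_homo (hH w))// ltW.
- move=> [q _ [r _]]; case: ifP => // /andP[qr ra] [/=]; rewrite in_itv/= => Tq Hqr.
  have q0 : 0 <= ratr q :> R := le_trans (jump_time_ge0 (hT w) n) (ltW Tq).
  have [s /andP[qs sr] js] := step_exists_jump (hH w) q0 Hqr.
  by rewrite (le_lt_trans _ ra)// (le_trans _ sr)// jump_time_min// (lt_trans Tq).
Qed.

(** * Palm measures *)

(* [all_analysis] shadows [counting] with the counting measure. *)
Local Notation counting := Defs.counting.

(** * Counting paths of a point process *)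

Section counting_paths.
Context {R : realType} {d : measure_display} {Omega : measurableType d}.
Variable N : Omega -> {measure set (measurableTypeR R) -> \bar R}.
Hypotheses (ppN : point_process N) (lfN : locally_finite N).

Local Open Scope ereal_scope.

Lemma countingE t w : (counting N t w)%:E = N w `]0%R, t]%classic.
Proof. by rewrite /counting fineK// ge0_fin_numE. Qed.

Lemma measure_itv_counting s t w : (0 <= s)%R -> (s <= t)%R ->
  N w `]s, t]%classic = (counting N t w - counting N s w)%:E.
Proof.
move=> s0 st; rewrite EFinB (countingE t).
have -> : (`]0%R, t] = `]0%R, s] `|` `]s, t])%classic.
  by rewrite -itv_bndbnd_setU// bnd_simp.
rewrite measureU// ?countingE.
  rewrite addeAC subee ?add0e//.
  by have : (counting N s w)%:E \is a fin_num by []; rewrite countingE.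
rewrite -subset0 => x []/=; rewrite !in_itv/= => /andP[_ xs] /andP[sx _].
by move: (lt_le_trans sx xs); rewrite ltxx.
Qed.

Lemma measurable_counting t : measurable_fun setT (counting N t).
Proof.
apply: measurableT_comp => //.
by apply: pp_measurable => //; exact: measurable_itv.
Qed.

Lemma counting_step_path w : (forall w, cadlag (counting N ^~ w)) ->
  step_path (counting N ^~ w).
Proof.
move=> cN; split.
- move=> t; have := pp_integer ppN w (measurable_itv `]0%R, t]).
  rewrite -countingE => -[//|[n [->]]]; by exists n.
- move=> s t st; rewrite -lee_fin !countingE le_measure ?inE//.
  by apply: subset_itvl; rewrite bnd_simp.
- exact: (cN w).1.
Qed.

Lemma counting0 w : counting N 0 w = 0%R.
Proof. by rewrite /counting set_itvoc0 measure0. Qed.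

(** The jump is the mass of an interval []s, t]] chosen so that the path is constant on [[s, t[].
    All of this mass then sits at [t], where simplicity bounds it by 1. *)
Lemma counting_jump01 w t : simple_pp N -> (forall w, cadlag (counting N ^~ w)) ->
  (0 < t)%R -> jump (counting N ^~ w) t != 0%R -> jump (counting N ^~ w) t = 1%R.
Proof.
move=> sN cN t0; have hh := counting_step_path w cN.
have [r rt rE] := step_left_lim t hh.
pose s := Num.max 0%R r.
have s0 : (0 <= s)%R by rewrite le_max lexx.
have st : (s < t)%R by rewrite gt_max t0 rt.
have rs : (r <= s)%R by rewrite le_max lexx orbT.
have jE : (jump (counting N ^~ w) t)%:E = N w `]s, t]%classic.
  by rewrite measure_itv_counting ?(ltW st)// /jump -(rE s) ?rs.
(* The path gives the mass of intervals closed on the right, so []s, t[] is exhausted by the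
   intervals []s, t - 1/(n+1)]], which may be empty for small [n]. *)
have null : N w `]s, t[%classic = 0.
  rewrite itv_bnd_open_bigcup; apply: measure_negligible.
    by apply: bigcupT_measurable => n; exact: measurable_itv.
  apply: negligible_bigcup => n; apply/negligibleP; first exact: measurable_itv.
  have [stn|tns] := leP s (t - n.+1%:R^-1)%R; last first.
    by rewrite set_itv_ge ?measure0// bnd_simp -leNgt ltW.
  have tnt : (t - n.+1%:R^-1 < t)%R by rewrite ltrBlDr ltrDl.
  have := measure_itv_counting w s0 stn.
  by rewrite !rE ?subrr ?rs ?(le_trans rs stn).
have U : N w `]s, t]%classic = N w `]s, t[%classic + N w [set t].
  rewrite -(setUitv1 true) ?bnd_simp// measureU//.
  by rewrite -subset0 => x []/=; rewrite in_itv/= => /andP[_ /[swap] ->]; rewrite ltxx.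
have j1 : (jump (counting N ^~ w) t <= 1)%R.
  by rewrite -lee_fin jE U null add0e; exact: sN.
have [n jn] := step_jump_nat t hh; move: j1; rewrite jn lern1 pnatr_eq0.
by case: n {jn} => [|[]].
Qed.

End counting_paths.

(** * The unnormalized Palm measure *)

Section palm_measure.
Context {R : realType} {d : measure_display} {Omega : measurableType d}.
Variables (P : probability Omega R) (Theta : R -> Omega -> Omega).
Variable tau : nat -> Omega -> R.
Hypothesis mTheta :
  measurable_fun ([set t : measurableTypeR R | 0 <= t] `*` [set: Omega])
    (fun p : measurableTypeR R * Omega => Theta p.1 p.2).
Hypothesis mtau : forall n, measurable_fun setT (tau n).
Hypothesis tau_ge0 : forall n w, 0 <= tau n w.

(** The shift is jointly measurable on nonnegative times only, hence the appeal to [tau_ge0]. *)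
Lemma measurable_shift_at n : measurable_fun setT (shift_at Theta (tau n)).
Proof.
apply: (@measurable_comp _ _ _ _ _ _ ([set t : measurableTypeR R | 0 <= t] `*` [set: Omega])
  (fun p : measurableTypeR R * Omega => Theta p.1 p.2) setT (fun w => (tau n w, w))).
- apply: measurableX => //.
  rewrite (_ : [set _ | _] = `[0%R, +oo[%classic).
    exact: (measurable_itv `[0%R, +oo[).
  by apply/seteqP; split => x /=; rewrite in_itv/= andbT.
- by move=> _ /= [w _ <-]; split => //=; exact: tau_ge0.
- exact: mTheta.
- by apply/measurable_fun_pairP; split; [exact: mtau|exact: measurable_id].
Qed.

Lemma measurable_tau_le1 n : measurable (tau n @^-1` [set s | s <= 1]).
Proof.
rewrite -[X in measurable X]setTI; apply: mtau => //.
exact: (measurable_itv `]-oo, 1%R]).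
Qed.

Local Open Scope ereal_scope.

(** This is $M_\tau$; with the intensity left out, different sequences of instants are related by
    plain equalities. *)
Definition palm_mass (A : set Omega) : \bar R :=
  \int[P]_w \sum_(1 <= n <oo)
    (\1_A (shift_at Theta (tau n) w) * \1_[set s : R | (s <= 1)%R] (tau n w))%:E.

Lemma palmE alpha A : palm P Theta alpha tau A = alpha^-1 * palm_mass A.
Proof. by []. Qed.

Let shifted_law n : {measure set Omega -> \bar R} :=
  measure_function_pushforward__canonical__measure_function_Measure
   (mrestr P (measurable_tau_le1 n)) (measurable_shift_at n).

Lemma measurable_palm_term A n : measurable A ->
  measurable_fun setT (fun w : Omega =>
    (\1_A (shift_at Theta (tau n) w) * \1_[set s : R | (s <= 1)%R] (tau n w))%:E : \bar R).
Proof.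
move=> mA; apply/measurable_EFinP; apply: measurable_funM.
  apply: (@measurableT_comp _ _ _ _ _ _ (\1_A : Omega -> R)) (measurable_shift_at n).
  exact: measurable_indic.
rewrite (_ : (fun _ => _) = \1_(tau n @^-1` [set s | (s <= 1)%R])).
  exact/measurable_indic/measurable_tau_le1.
by apply/funext => w; rewrite !indicE.
Qed.

Lemma integral_palm_term A n : measurable A ->
  \int[P]_w
    (\1_A (shift_at Theta (tau n) w) * \1_[set s : R | (s <= 1)%R] (tau n w))%:E
  = shifted_law n A.
Proof.
move=> mA; rewrite [RHS]/= /pushforward /mrestr.
have mS := measurable_shift_at n measurableT mA; rewrite setTI in mS.
rewrite -[X in P X]setIT -integral_indic//; last first.
  by apply: measurableI => //; exact: measurable_tau_le1.
by apply: eq_integral => w _; rewrite !indicE in_setI -natrM mulnb.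
Qed.

(** Exchanging expectation and series presents [palm_mass] as the sum of the laws of the shifted
    outcomes, the [n]-th one being taken on the event [tau n <= 1]. *)
Lemma measure_palm_mass : exists mu : {measure set Omega -> \bar R},
  forall A, measurable A -> mu A = palm_mass A.
Proof.
exists (mseries shifted_law 1) => A mA.
rewrite /palm_mass; under eq_integral do rewrite ereal_series eseries_mkcond.
rewrite integral_nneseries//; last 2 first.
- by move=> [|n]; [exact: measurable_cst|exact: measurable_palm_term].
- by move=> n w _; case: ifP => // _; rewrite lee_fin.
rewrite /mseries [LHS]ereal_series eseries_mkcond; apply: eq_eseriesr => n _.
by case: n => [|n] /=; [rewrite integral0|rewrite integral_palm_term].
Qed.

End palm_measure.

Import HBNNSimple.

(* Unlike [eq_measure_integral], [m] is only required to agree with a measure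
   on measurable sets, as is the case of [palm]. *)
Lemma eq_setfun_integral {R : realType} {d : measure_display} {T : measurableType d}
  (m : set T -> \bar R) (mu : {measure set T -> \bar R}) (D : set T) (f : T -> \bar R) :
  (forall A, measurable A -> m A = mu A) ->
  (\int[m]_(x in D) f x = \int[mu]_(x in D) f x)%E.
Proof.
move=> mmu; rewrite /integral.
have E (h : {nnsfun T >-> R}) : sintegral m h = sintegral mu h.
  by apply: eq_fsbigr => x _; rewrite mmu.
by congr (ereal_sup _ - ereal_sup _)%E; apply/seteqP; split => _ [h hf <-];
  exists h => //; rewrite E.
Qed.

(** * Integrals under scaled and restricted measures *)

Section integral_lemmas.
Context {R : realType} {d : measure_display} {T : measurableType d}.
Variable mu : {measure set T -> \bar R}.
Local Open Scope ereal_scope.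

(** Integrability makes the integral of the positive part finite, so [c] factors out of the
    difference of the two parts. *)
Lemma integral_scaled_measure (m : set T -> \bar R) (c : R) (D : set T) (f : T -> \bar R) :
  (0 <= c)%R -> (forall A, measurable A -> m A = c%:E * mu A) ->
  measurable D -> mu.-integrable D f ->
  \int[m]_(x in D) f x = c%:E * \int[mu]_(x in D) f x.
Proof.
move=> c0 mE mD intf.
rewrite (@eq_setfun_integral _ _ _ m (mscale (NngNum c0) mu))//.
have mf := measurable_int mu intf.
rewrite integralE [in RHS]integralE !ge0_integral_mscale//=; last 2 first.
- exact: measurable_funeneg.
- exact: measurable_funepos.
rewrite [RHS]muleBr//; apply: fin_num_adde_defr.
exact: integrable_pos_fin_num.
Qed.

Lemma integral_mrestr (D : set T) (mD : measurable D) (f : T -> \bar R) :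
  measurable_fun setT f ->
  \int[mrestr mu mD]_x f x = \int[mu]_(x in D) f x.
Proof.
move=> mf.
have nD : mrestr mu mD (~` D) = 0 by rewrite /mrestr setICl measure0.
transitivity (\int[mrestr mu mD]_(x in D) f x); last first.
  by apply: eq_measure_integral => A mA AD /=; rewrite /mrestr setIidl.
rewrite [RHS]integral_mkcond; apply: ae_eq_integral => //.
  exact/(measurable_restrictT _ mD)/measurable_funTS.
exists (~` D); split => //; first exact: measurableC.
by move=> x /= /not_implyP[_]; rewrite patchE; case: ifPn => //; rewrite notin_setE.
Qed.

Lemma integral_ae_support (D B : set T) (f : T -> \bar R) :
  measurable D -> measurable B -> measurable_fun setT f -> mu B = 0 ->
  (forall x, ~ D x -> ~ B x -> f x = 0) ->
  \int[mu]_x f x = \int[mu]_(x in D) f x.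
Proof.
move=> mD mB mf B0 f0; rewrite [RHS]integral_mkcond; apply: ae_eq_integral => //.
  exact/(measurable_restrictT _ mD)/measurable_funTS.
exists B; split => // x /= /not_implyP[_ fx]; apply: contrapT => nB; apply: fx.
by rewrite patchE; case: ifPn => //; rewrite notin_setE => /f0 ->.
Qed.

End integral_lemmas.

Lemma continuous_measurable_wrt {R : realType} {d : measure_display}
  {Omega : measurableType d} {S : topologicalType} (f : S -> R) (Z : Omega -> S) :
  continuous f -> measurable_wrt (@measurable _ Omega) Z ->
  measurable_fun setT (f \o Z).
Proof.
move=> /continuousP cf mZ; apply: (measurability _ (RGenOpens.measurableE R)).
move=> _ [_ [a [b ->] <-]]; rewrite setTI comp_preimage; apply: mZ.
by apply: sub_sigma_algebra; exact/cf/interval_open.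
Qed.

(** * Comparison of the Palm distributions *)

Section palm_relations.
Context {R : realType} {disp : measure_display} {Omega : measurableType disp}.
Variables (P : probability Omega R) (F : R -> set (set Omega))
  (Theta : R -> Omega -> Omega) (d k : nat) (X : R -> Omega -> 'rV[R]_(d + k))
  (N : 'I_k -> Omega -> {measure set (measurableTypeR R) -> \bar R})
  (Kp : {set 'I_k})
  (Xzm : Omega -> 'rV[R]_(d + k)) (DNz : 'I_k -> Omega -> R)
  (Y : 'I_k.+1 -> nat -> Omega -> 'rV[R]_(d + k)).
Hypotheses (hN : forall j, point_process (N j)) (hM1 : M1 F Theta X N)
  (hM2 : M2 Kp N) (hzero : before_zero Theta X N Xzm DNz)
  (hM4 : M4 F Theta X N Xzm DNz Y) (hD2 : D2 Kp N P).

Lemma M2_locally_finite j : locally_finite (N j).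
Proof.
have [jK|jK] := boolP (j \in Kp); first by have [] := M2_simple hM2 jK.
by move=> w t; rewrite (M2_null hM2 jK)//; exact: measurable_itv.
Qed.

Lemma M2_step_path j w : step_path (counting (N j) ^~ w).
Proof.
apply: counting_step_path => //; first exact: M2_locally_finite.
exact: M1_cadlag_N hM1 j.
Qed.

Lemma Nall_step_path w : step_path (Nall N ^~ w).
Proof. by apply: step_path_sum => j; exact: M2_step_path. Qed.

Lemma M2_jump01 j w t : j \in Kp -> 0 < t ->
  jump (counting (N j) ^~ w) t != 0 -> jump (counting (N j) ^~ w) t = 1.
Proof.
move=> jK; apply: counting_jump01 => //; first exact: M2_locally_finite.
  by have [] := M2_simple hM2 jK.
exact: M1_cadlag_N hM1 j.
Qed.

Lemma M2_jump_null j w t : j \notin Kp -> jump (counting (N j) ^~ w) t = 0.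
Proof.
move=> jK; have c0 s : counting (N j) s w = 0.
  by rewrite /counting (M2_null hM2 jK)//; exact: measurable_itv.
have [s st sE] := step_left_lim t (M2_step_path j w).
by rewrite /jump -(sE s) ?lexx// !c0 subrr.
Qed.

(** The jumps of the $N_j$ are nonnegative and cannot cancel in the sum. *)
Lemma Nall_jump_eq0 w t :
  (jump (Nall N ^~ w) t == 0) = [forall j, jump (counting (N j) ^~ w) t == 0].
Proof.
rewrite (@jump_sum _ _ _ (fun j => counting (N j) ^~ w)); last first.
  by move=> j; exact: M2_step_path.
rewrite psumr_eq0; last first.
  by move=> j _; have [n ->] := step_jump_nat t (M2_step_path j w).
apply/allP/forallP => [H j|H j _]; first by apply: H; rewrite mem_index_enum.
exact: H.
Qed.

Lemma measurable_t_all n : measurable_fun setT (t_all N n).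
Proof.
apply: measurable_jump_time.
- by move=> t; apply: measurable_sum => j; exact: measurable_counting.
- exact: Nall_step_path.
- exact: M2_instants_all hM2.
Qed.

Lemma t_all_gt0 n w : (0 < n)%N -> 0 < t_all N n w.
Proof. by case: n => // n _; exact: jump_time_gt0 (M2_instants_all hM2 w) n. Qed.

Local Open Scope ereal_scope.
Local Notation mass0 := (palm_mass P Theta (t_all N)).
Local Notation mass j := (palm_mass P Theta (instant (N j))).
Local Notation D j := [set w | DNz j w = 1%R].

(** The identity holds outcome by outcome: both series are sums over times, and the instants of
    $N_j$ are the jump times of $N_{\rm all}$ lying in [J]. *)
Lemma palm_mass_instant j A : j \in Kp -> mass j A = mass0 (A `&` D j).
Proof.
move=> jK; apply: eq_integral => w _.
pose a s : \bar R := (\1_A (Theta s w) * \1_[set s : R | (s <= 1)%R] s)%:E.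
have a0 s : 0 <= a s by rewrite lee_fin mulr_ge0.
pose J := [set s : R | jump (counting (N j) ^~ w) s = 1%R].
pose b s : \bar R := if s \in J then a s else 0.
have b0 s : 0 <= b s by rewrite /b; case: ifP.
transitivity (\sum_(1 <= n <oo) a (instant (N j) n w)); first by [].
rewrite (nneseries_jump_time (M2_step_path j w) (M2_instants hM2 jK w) a0).
transitivity (\sum_(1 <= n <oo) b (t_all N n w)).
  rewrite (nneseries_jump_time (Nall_step_path w) (M2_instants_all hM2 w) b0).
  rewrite /b -esum_mkcondr; congr esum; apply/seteqP; split => s /=.
    move=> [s0 js]; split; last exact: M2_jump01.
    by split=> //; rewrite Nall_jump_eq0; apply/forallPn; exists j.
  by move=> [[s0 _] ->]; rewrite oner_eq0.
rewrite ereal_series [RHS]ereal_series; apply: eq_eseriesr => n n1.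
rewrite /b /a !indicE in_setI.
(* Membership of the time in [J] is read off after the shift by [DNz]; the indices in play are at
   least 1, as [bz_shift_N] demands. *)
have -> : (shift_at Theta (t_all N n) w \in D j) = (t_all N n w \in J).
  by apply/idP/idP; rewrite !inE/= (bz_shift_N hzero).
by rewrite /shift_at; case: ifP => //=; rewrite ?andbT// andbF mul0r.
Qed.

(** Turns facts about [DNz] known only after a shift by some $t_n$ into almost everywhere
    statements. *)
Lemma palm_mass_null B :
  (forall n w, (0 < n)%N -> ~ B (shift_at Theta (t_all N n) w)) -> mass0 B = 0.
Proof.
move=> nB; apply: integral0_eq => w _; apply: eseries0 => n n1 _.
by rewrite indicE memNset ?mul0r//; exact: nB.
Qed.

(** As $N_j$ has unit jumps, it has $N_j(1)$ instants up to time 1. *)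
Lemma mass_setT j : j \in Kp -> mass j setT = alpha P N j.
Proof.
move=> jK; rewrite /alpha unlock; apply: eq_integral => w _.
rewrite (@unit_jump_path _ (counting (N j) ^~ w))//.
- by apply: eq_eseriesr => n _; rewrite indicT mul1r.
- exact: M2_step_path.
- exact: M2_instants hM2 j jK w.
- exact: counting0.
- by move=> s; exact: M2_jump01.
Qed.

Lemma mass0_setT : mass0 setT = alpha0 P N.
Proof.
apply: eq_integral => w _; apply: eq_eseriesr => n _.
by rewrite indicT mul1r.
Qed.

Variable mu0 : {measure set Omega -> \bar R}.
Hypothesis mu0E : forall A, measurable A -> mu0 A = mass0 A.

Lemma measurable_DNz j : measurable_fun setT (DNz j).
Proof.
apply: (continuous_measurable_wrt (f := id)) (bz_measurable_N hzero j) => x.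
exact: cvg_id.
Qed.

Lemma measurable_DNz_eq j (c : R) : measurable [set w | DNz j w = c].
Proof.
rewrite -[X in measurable X]setTI.
exact: (measurable_DNz j measurableT (measurable_set1 c)).
Qed.
#[local] Hint Resolve measurable_DNz_eq : core.

Lemma mu0_D j : j \in Kp -> mu0 (D j) = alpha P N j.
Proof.
by move=> jK; rewrite mu0E// -(mass_setT jK)
  palm_mass_instant// setTI.
Qed.

Lemma alpha0E : mu0 setT = alpha0 P N.
Proof. by rewrite mu0E// mass0_setT. Qed.

Lemma t_all_jump n w : (0 < n)%N ->
  exists2 j, j \in Kp & jump (counting (N j) ^~ w) (t_all N n w) = 1%R.
Proof.
move=> n0; have : jump (Nall N ^~ w) (t_all N n w) != 0%R.
  by case: n n0 => // n _; apply: jump_timeS_jump;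
    [exact: Nall_step_path|exact: M2_instants_all hM2 w].
rewrite Nall_jump_eq0 => /forallPn[j jn].
have jK : j \in Kp by apply: contraNT jn => /M2_jump_null ->.
by exists j => //; exact: (M2_jump01 jK (t_all_gt0 w n0) jn).
Qed.

(** A probability space has an outcome, and its instant $t_1$ is a jump of some $N_j$. The index so
    found serves to show that $\alpha_0$ is positive. *)
Lemma Kp_neq0 : exists j, j \in Kp.
Proof.
have [w _] : [set: Omega] !=set0.
  apply/set0P/eqP => T0; have := probability_setT P.
  by rewrite T0 measure0 => /eqP; rewrite eq_sym onee_eq0.
by have [j jK _] := t_all_jump w (ltn0Sn 0); exists j.
Qed.

(** Every $t_n$ is an instant of some $N_j$, so [mu0] is carried by the finite union of the events
    [D j], each of finite mass $\alpha_j$. *)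
Lemma alpha0_lty : alpha0 P N < +oo.
Proof.
pose U := \big[setU/set0]_(j in Kp) D j.
have [mU U_lty] : measurable U /\ mu0 U < +oo.
  rewrite /U; apply: (@big_ind _ (fun A => measurable A /\ mu0 A < +oo)).
  - by rewrite measure0; split.
  - move=> A B [mA Aoo] [mB Boo]; split; first exact: measurableU.
    by rewrite (le_lt_trans (measureU2 _ _ _))// lte_add_pinfty.
  - by move=> j jK; rewrite mu0_D//; split => //; have /andP[] := hD2 jK.
have nU : mu0 (~` U) = 0.
  rewrite mu0E; last exact: measurableC.
  apply: palm_mass_null => n w n0; apply.
  have [j jK j1] := t_all_jump w n0.
  by rewrite /U (bigD1 j)//=; left; rewrite /= (bz_shift_N hzero).
rewrite -alpha0E -(setUv U) (le_lt_trans (measureU2 _ _ _))//; last first.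
  by rewrite [X in _ + X]nU adde0.
exact: measurableC.
Qed.

Lemma alpha0_gt0 j : j \in Kp -> 0 < alpha0 P N.
Proof.
move=> jK; have /andP[aj0 _] := hD2 jK.
by rewrite -alpha0E (lt_le_trans aj0)// -mu0_D// le_measure// inE.
Qed.

Variable f : 'rV[R]_(d + k) -> R.
Hypotheses (cf : continuous f) (bf : bounded_fun f).
Local Notation Z j := (Delta_jf f Y j 0).

Lemma measurable_Delta_jf j : measurable_fun setT (Z j).
Proof.
by apply: measurable_funB; apply: (continuous_measurable_wrt cf); exact: M4_rv hM4 _ _.
Qed.

Lemma integrable_Delta_jf (nu : {measure set Omega -> \bar R}) j :
  nu setT < +oo -> nu.-integrable setT (EFin \o Z j).
Proof.
move=> nu_lty; apply: measurable_bounded_integrable => //.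
  exact: measurable_Delta_jf.
have [M [_ bM]] := bf.
(* Every number above [M] bounds [|f|], in particular [|M| + 1]; a difference of two values of [f]
   doubles the bound. *)
exists (2 * (`|M| + 1))%R; split => // B MB w _ /=.
have fM x : (`|f x| <= `|M| + 1)%R.
  by apply: bM => //; rewrite ltr_pwDr// ler_norm.
rewrite (le_trans (ler_normB _ _))// (le_trans _ (ltW MB))//.
by rewrite mulrDl mul1r lerD.
Qed.

Lemma mu0_integrable_Delta_jf j : mu0.-integrable setT (EFin \o Z j).
Proof. by apply: integrable_Delta_jf; rewrite alpha0E alpha0_lty. Qed.

Lemma Delta_jf_eq0 j w : DNz j w = 0%R -> Z j w = 0%R.
Proof.
move=> DN0; rewrite /Delta_jf (M4a_const hM4) ?subrr//.
(* As $t_0 = 0$, [DeltaN] takes its value from [DNz]. *)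
by rewrite /DeltaN /t_all /= eqxx.
Qed.

Lemma integral_Delta_jf j : j \in Kp ->
  \int[mu0]_w (Z j w)%:E = \int[mu0]_(w in D j) (Z j w)%:E.
Proof.
(* [B] gathers the values of [DNz] other than 0 and 1, which never occur after a shift by some
   $t_n$. *)
move=> jK; pose B := ~` (D j `|` [set w | DNz j w = 0%R]).
have mB : measurable B by apply: measurableC; exact: measurableU.
apply: (@integral_ae_support _ _ _ _ _ B) => //.
- exact/measurable_EFinP/measurable_Delta_jf.
- rewrite mu0E//; apply: palm_mass_null => n w n0; apply => /=.
  rewrite (bz_shift_N hzero)//.
  have [->|j0] := eqVneq (jump (counting (N j) ^~ w) (t_all N n w)) 0%R; first by right.
  by left; exact: (M2_jump01 jK (t_all_gt0 w n0) j0).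
- move=> w nD nB; rewrite Delta_jf_eq0//.
  by move: nB => /contrapT[].
Qed.

Lemma integral_Delta_jf_null j : j \notin Kp -> \int[mu0]_w (Z j w)%:E = 0.
Proof.
move=> jK; pose B := ~` [set w | DNz j w = 0%R].
have mB : measurable B by apply: measurableC.
rewrite (@integral_ae_support _ _ _ _ set0 B) ?integral_set0//.
- exact/measurable_EFinP/measurable_Delta_jf.
- rewrite mu0E//; apply: palm_mass_null => n w n0; apply => /=.
  by rewrite (bz_shift_N hzero)// M2_jump_null.
- by move=> w _ /contrapT w0; rewrite Delta_jf_eq0.
Qed.

Lemma Delta_f_sum w : Delta_f f X Xzm 0 w = (\sum_(j < k) Z j w)%R.
Proof.
rewrite /Delta_f -(M4a_first hM4 0%N w) -(M4a_last hM4 0%N w).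
(* [inord] extends the index to all naturals, as the telescoping sum requires; the two ends are
   $X(0-)$ and $X(0)$. *)
pose g i := f (Y (inord i) 0%N w).
rewrite (eq_bigr (fun j : 'I_k => g j.+1 - g j)%R); last first.
  by move=> j _; rewrite /Delta_jf /g; congr (f (Y _ _ _) - f (Y _ _ _))%R;
    apply/val_inj; rewrite /= inordK// ltnS// ltnW.
rewrite -(big_mkord xpredT (fun j => g j.+1 - g j)%R) telescope_sumr//.
by rewrite /g; congr (f (Y _ _ _) - f (Y _ _ _))%R; apply/val_inj; rewrite /= inordK.
Qed.

Lemma fin_alpha j : j \in Kp -> exists2 a : R, (0 < a)%R & alpha P N j = a%:E.
Proof.
move=> /hD2; case: (alpha P N j) => [a| |]//; rewrite ?ltxx ?andbF// => /andP[a0 _].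
by exists a.
Qed.

(** By [palm_mass_instant], $\mathbb{P}_j$ is [mu0] restricted to [D j] and divided by $\alpha_j$,
    which is positive and finite and thus cancels. *)
Lemma expect_palm_at j : j \in Kp ->
  alpha P N j * expect (palm_at P Theta N j) (Z j) = \int[mu0]_(w in D j) (Z j w)%:E.
Proof.
move=> jK; have [a a0 aE] := fin_alpha jK.
have mZ := measurable_Delta_jf j.
rewrite /expect (@integral_scaled_measure _ _ _ (mrestr mu0 (measurable_DNz_eq j 1)) _ a^-1)//.
- rewrite aE muleA -EFinM divff ?gt_eqF// mul1e integral_mrestr//.
  exact/measurable_EFinP.
- by rewrite invr_ge0 ltW.
- move=> A mA; rewrite /palm_at palmE aE inver gt_eqF//; congr (_ * _).
  rewrite palm_mass_instant// /mrestr -mu0E//.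
  exact: measurableI.
- apply: integrable_Delta_jf.
  by rewrite /= /mrestr setTI mu0_D// aE ltry.
Qed.

Lemma palm0E a : (0 < a)%R -> alpha0 P N = a%:E ->
  forall A, measurable A -> palm0 P Theta N A = (a^-1)%:E * mu0 A.
Proof. by move=> a0 aE A mA; rewrite /palm0 palmE aE inver gt_eqF// mu0E. Qed.

Lemma fin_alpha0 j : j \in Kp -> exists2 a : R, (0 < a)%R & alpha0 P N = a%:E.
Proof.
move=> /alpha0_gt0; move: alpha0_lty; case: (alpha0 P N) => [a| |]// _ a0.
by exists a.
Qed.

(** The factor $1/\alpha_0$ cancels between numerator and denominator, leaving the integral over
    [D j] divided by [mu0 (D j)], which is $\alpha_j$. *)
Lemma cond_expect_palm0 j : j \in Kp ->
  cond_expect (palm0 P Theta N) (Z j) [set w | DeltaN N DNz j 0 w = 1%R]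
  = expect (palm_at P Theta N j) (Z j).
Proof.
move=> jK; have [a a0 aE] := fin_alpha jK; have [a' a'0 a'E] := fin_alpha0 jK.
have -> : [set w | DeltaN N DNz j 0 w = 1%R] = D j.
  by apply/seteqP; split => w /=; rewrite /DeltaN eqxx.
have intZ := integrableS measurableT (measurable_DNz_eq j 1) (@subsetT _ _)
  (mu0_integrable_Delta_jf j).
rewrite /cond_expect (integral_scaled_measure _ (palm0E a'0 a'E))//; last first.
  by rewrite invr_ge0 ltW.
rewrite (palm0E a'0 a'E)// mu0_D// -expect_palm_at// aE.
rewrite -EFinM inver mulf_eq0 invr_eq0 !gt_eqF//= muleA -EFinM muleAC -EFinM.
by rewrite divff ?mul1e// mulf_neq0 ?invr_eq0 ?gt_eqF.
Qed.

Lemma sum_expect_palm :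
  alpha0 P N * expect (palm0 P Theta N) (Delta_f f X Xzm 0) =
  \sum_(j in Kp) alpha P N j * expect (palm_at P Theta N j) (Z j).
Proof.
have [j jK] := Kp_neq0; have [a a0 aE] := fin_alpha0 jK.
(* Each summand becomes an integral over [D j], then over the whole space. *)
rewrite (eq_bigr _ expect_palm_at) -(eq_bigr _ integral_Delta_jf).
have DE : (fun w => (Delta_f f X Xzm 0 w)%:E) = (fun w => \sum_(i < k) (Z i w)%:E).
  by apply/funext => w; rewrite Delta_f_sum sumEFin.
rewrite /expect DE (integral_scaled_measure _ (palm0E a0 aE))//; last 2 first.
- by rewrite invr_ge0 ltW.
- by apply: integrable_sum => // i _; exact: mu0_integrable_Delta_jf.
rewrite aE muleA -EFinM divff ?gt_eqF// mul1e.
rewrite integral_sum//; last exact: mu0_integrable_Delta_jf.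
(* The telescoping sum runs over all of $K$; the indices outside $K_+$ contribute 0. *)
by rewrite [RHS]big_mkcond; apply: eq_bigr => i _; case: ifPn => // /integral_Delta_jf_null.
Qed.

End palm_relations.

Theorem lemma2p1 (R : realType) (disp : measure_display)
  (Omega : measurableType disp) (P : probability Omega R)
  (F : R -> set (set Omega)) (Theta : R -> Omega -> Omega)
  (d k : nat) (hd : (0 < d)%N) (hk : (0 < k)%N)
  (X : R -> Omega -> 'rV[R]_(d + k))
  (N : 'I_k -> Omega -> {measure set (measurableTypeR R) -> \bar R})
  (Kp : {set 'I_k})
  (Xzm : Omega -> 'rV[R]_(d + k)) (DNz : 'I_k -> Omega -> R)
  (Y : 'I_k.+1 -> nat -> Omega -> 'rV[R]_(d + k))
  (hF : is_filtration F) (hTheta : is_shift Theta)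
  (hN : forall j, point_process (N j))
  (hM1 : M1 F Theta X N) (hM2 : M2 Kp N) (hM3 : M3 X N)
  (hzero : before_zero Theta X N Xzm DNz)
  (hM4 : M4 F Theta X N Xzm DNz Y)
  (hD1 : D1 F Theta P) (hD2 : D2 Kp N P) :
  forall f : 'rV[R]_(d + k) -> R, continuous f -> bounded_fun f ->
    (forall j, j \in Kp ->
       cond_expect (palm0 P Theta N) (Delta_jf f Y j 0)
         [set w | DeltaN N DNz j 0 w = 1]
       = expect (palm_at P Theta N j) (Delta_jf f Y j 0)) /\
    (alpha0 P N * expect (palm0 P Theta N) (Delta_f f X Xzm 0)
     = \sum_(j in Kp) alpha P N j * expect (palm_at P Theta N j) (Delta_jf f Y j 0))%E.
Proof.
move=> f cf bf.
have [mu0 mu0E] := @measure_palm_mass _ _ _ P Theta (t_all N)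
  (M1_shift_measurable hM1) (measurable_t_all hN hM1 hM2)
  (fun n w => jump_time_ge0 (M2_instants_all hM2 w) n).
split=> [j jK|].
  exact: (cond_expect_palm0 hN hM1 hM2 hzero hM4 hD2 mu0E cf bf jK).
exact: (sum_expect_palm hN hM1 hM2 hzero hM4 hD2 mu0E cf bf).
Qed.
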